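(* Let $m\ge1$, $k\ge 2$, let $R\in\mathbb{Z}_{2^k}^{m\times m}$ be symmetric, and let $a,b\in\mathbb{Z}^m$ with binary expansions $a=a_0+2a_1+4a_2+\cdots$, $b=b_0+2b_1+4b_2+\cdots$, where $a_i,b_i\in\{0,1\}^m$. Then $$\tau_R^{(k)}E(a,b)(\tau_R^{(k)})^\dagger=\xi^{\phi(R,a,b,k)}\,E([a_0,b_0]\Gamma_R)\,\tau^{(k-1)}_{\tilde R(R,a,k)},$$ where $\xi=\exp(2\pi\imath/2^k)$, $[a_0,b_0]\Gamma_R=[a_0,\,b_0+a_0R]$, the global phase exponent is $$\phi(R,a,b,k)=(1-2^{k-2})\,a_0Ra_0^T+2^{k-1}(a_0b_1^T+b_0a_1^T),$$ and $$\tilde R(R,a,k)=(1+2^{k-2})D_{a_0R}-\left(D_{\bar a_0}RD_{a_0}+D_{a_0}RD_{\bar a_0}+2D_{a_0RD_{a_0}}\right)$$ is a symmetric matrix over $\mathbb{Z}_{2^{k-1}}$. Therefore, up to a global phase, $\tau_R^{(k)}E(a,b)(\tau_R^{(k)})^\dagger\equiv E(a_0,\,b_0+a_0R)\,\tau^{(k-1)}_{\tilde R(R,a,k)}$.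
   Context: Let $N=2^m$, with standard basis $e_v=|v\rangle$ of $\mathbb{C}^N=(\mathbb{C}^2)^{\otimes m}$ indexed by row vectors $v\in\{0,1\}^m=\mathbb{Z}_2^m$, and $\imath=\sqrt{-1}$. Let $X=\begin{bmatrix}0&1\\1&0\end{bmatrix}$, $Z=\begin{bmatrix}1&0\\0&-1\end{bmatrix}$. For integer row vectors $x,y\in\mathbb{Z}^m$ put $D(x,y)=X^{x_1}Z^{y_1}\otimes\cdots\otimes X^{x_m}Z^{y_m}$ and $E(x,y)=\imath^{xy^T \bmod 4}D(x,y)$, where $xy^T=\sum_i x_iy_i$ is computed over $\mathbb{Z}$; $E(x,y)$ depends only on $x,y$ modulo $4$. We write $E([x,y])=E(x,y)$. For $j\ge1$ and symmetric $S\in\mathbb{Z}_{2^j}^{m\times m}$ ($\mathbb{Z}_{2^j}$ the ring of integers modulo $2^j$), $\tau_S^{(j)}=\sum_{v\in\mathbb{Z}_2^m}\exp(2\pi\imath/2^j)^{\,vSv^T \bmod 2^j}\,|v\rangle\langle v|$, with entries of $v$ regarded as integers $0,1$. $\Gamma_R=\begin{bmatrix}I_m&R\\0&I_m\end{bmatrix}$. For a row vector $x$, $D_x=\mathrm{diag}(x)$ is the diagonal matrix with diagonal $x$; for $w\in\{0,1\}^m$, $\bar w=\underline{1}-w$ with $\underline 1$ the all-ones vector. Entries of $R$ may be represented by integers: exponents of $\xi$ are read modulo $2^k$, and the entries of $\tilde R$ modulo $2^{k-1}$; since $k\ge2$, $E(a_0,b_0+a_0R)$ is well defined. Only the digits $a_0,a_1,b_0,b_1$,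 determined by $a\equiv a_0+2a_1$ and $b\equiv b_0+2b_1 \pmod 4$, matter. *)

(* Defs.v *)
From HB Require Import structures.
From mathcomp Require Import all_boot all_order all_algebra.
From mathcomp Require Import complex mxtens.
From mathcomp Require Import reals sequences exp trigo.

Set Implicit Arguments.
Unset Strict Implicit.
Unset Printing Implicit Defensive.

Import Order.TTheory GRing.Theory Num.Theory.
Local Open Scope ring_scope.
Local Open Scope complex_scope.
Local Open Scope sesquilinear_scope.

(* The complex numbers are K[i] for K : realType. *)

Section Operators.
Variable K : realType.
Local Notation C := K[i].

Definition cexp (z : C) : C :=
  (expR (complex.Re z))%:C * (cos (complex.Im z) +i* sin (complex.Im z)).

Definition xi (j : nat) : C := cexp (2 * pi%:C * 'i%C / 2 ^+ j).

(* A_0 (x) A_1 (x) ... (x) A_(m-1), the index of the leftmost factor being the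
   most significant one. *)
Fixpoint tensor (p q m : nat) : ('I_m -> 'M[C]_(p, q)) -> 'M[C]_(p ^ m, q ^ m) :=
  match m with
  | 0 => fun=> (1%:M : 'M_1)
  | m'.+1 => fun A =>
      castmx (esym (expnS p m'), esym (expnS q m'))
        (A ord0 *t tensor (fun i => A (lift ord0 i)))
  end.

Definition pauliX : 'M[C]_2 := \matrix_(i, j) (i != j)%:R.
Definition pauliZ : 'M[C]_2 := \matrix_(i, j) ((i == j)%:R * (-1) ^+ i).

Variable m : nat.

(* The powers are integer powers in the ring of 2 x 2 matrices. *)
Definition opD (x y : 'rV[int]_m) : 'M[C]_(2 ^ m) :=
  tensor (fun i => pauliX ^ x ord0 i * pauliZ ^ y ord0 i).

Definition opE (x y : 'rV[int]_m) : 'M[C]_(2 ^ m) :=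
  'i%C ^ ((x *m y^T) ord0 ord0 %% 4)%Z *: opD x y.

Definition opE_row (z : 'rV[int]_(m + m)) : 'M[C]_(2 ^ m) :=
  opE (lsubmx z) (rsubmx z).

(* |v> = e_(v_0) (x) ... (x) e_(v_(m-1)); the cast only identifies 1 ^ m with 1. *)
Definition ket (v : 'rV['Z_2]_m) : 'cV[C]_(2 ^ m) :=
  castmx (erefl, exp1n m) (tensor (fun i => delta_mx (v 0 i) (0 : 'I_1))).

(* v as a row vector with entries 0 and 1 modulo 2 ^ j. *)
Definition bits_mod (j : nat) (v : 'rV['Z_2]_m) : 'rV['Z_(2 ^ j)]_m :=
  \row_i (v 0 i : nat)%:R.

(* Meaningful for j >= 1 only: 'Z_1 is the ring of integers modulo 2. The
   exponent is the representative in [0, 2 ^ j) of an element of 'Z_(2 ^ j). *)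
Definition tau (j : nat) (S : 'M['Z_(2 ^ j)]_m) : 'M[C]_(2 ^ m) :=
  \sum_(v : 'rV['Z_2]_m)
    xi j ^+ ((bits_mod j v *m S *m (bits_mod j v)^T) 0 0 : 'Z_(2 ^ j)) *:
      (ket v *m (ket v)^t*).

(* Equality up to a global phase, a complex number of modulus 1. *)
Definition phase_eq (A B : 'M[C]_(2 ^ m)) : Prop :=
  exists2 c : C, `|c| = 1 & A = c *: B.

End Operators.

Section IntegerData.
Variable m : nat.

Definition reduce (n : nat) (A : 'M[int]_m) : 'M['Z_n]_m :=
  map_mx (fun z : int => z%:~R) A.

(* The i-th binary digit of each entry. The quotient is rounded down, so the
   digits of a negative entry are its 2-adic digits, and
   a = digit 0 a + 2 * digit 1 a modulo 4 always holds. *)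
Definition digit (i : nat) (a : 'rV[int]_m) : 'rV[int]_m :=
  map_mx (fun z : int => ((z %/ (2 ^+ i)%R)%Z %% 2)%Z) a.

Definition bar (w : 'rV[int]_m) : 'rV[int]_m := const_mx 1 - w.

Definition Gamma (R : 'M[int]_m) : 'M[int]_(m + m) :=
  block_mx 1%:M R 0 1%:M.

Definition phi (R : 'M[int]_m) (a b : 'rV[int]_m) (k : nat) : int :=
  let a0 := digit 0 a in let a1 := digit 1 a in
  let b0 := digit 0 b in let b1 := digit 1 b in
  (1 - 2 ^+ (k - 2)) * (a0 *m R *m a0^T) 0 0
  + 2 ^+ (k - 1) * ((a0 *m b1^T) 0 0 + (b0 *m a1^T) 0 0).

Definition Rtilde (R : 'M[int]_m) (a : 'rV[int]_m) (k : nat) :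
    'M['Z_(2 ^ (k - 1))]_m :=
  let a0 := digit 0 a in
  reduce (2 ^ (k - 1))
    ((1 + 2 ^+ (k - 2)) *: diag_mx (a0 *m R)
     - (diag_mx (bar a0) *m R *m diag_mx a0
        + diag_mx a0 *m R *m diag_mx (bar a0)
        + 2 *: diag_mx (a0 *m R *m diag_mx a0))).

End IntegerData.

(* Main.v *)
(* Both sides are compared on the kets |v>, which form an orthonormal basis. There
   tau is diagonal, and E(x, y) maps |v> to |v + x mod 2> up to the phase
   'i ^ (x y^T) (-1) ^ (y v^T). With a_0 and v read as 0-1 integer vectors,
   w = v + a_0 mod 2 equals v + a_0 - 2 (v o a_0) (o the entrywise product), so
   w R w^T - v R v^T can be expanded by bilinearity. Writing all phases as powers
   of xi ('i = xi ^ (2 ^ (k - 2)), -1 = xi ^ (2 ^ (k - 1))), the claim becomes a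
   congruence of exponents modulo 2 ^ k, where the two sides differ by a multiple
   of 4 * 2 ^ (k - 2). *)
Require Import Defs.
From mathcomp Require Import all_boot all_order all_algebra.
From mathcomp Require Import complex mxtens ring.
From mathcomp Require Import reals sequences exp trigo.

Set Implicit Arguments.
Unset Strict Implicit.
Unset Printing Implicit Defensive.

Import Order.TTheory GRing.Theory Num.Theory.
Local Open Scope ring_scope.

(** * The roots of unity [xi K j] of order 2^j *)

Section RootsOfUnity.
Variable K : realType.
Local Notation C := K[i].

Lemma cexpD (z w : C) : cexp (z + w) = cexp z * cexp w.
Proof.
case: z w => [zr zi] [wr wi]; rewrite /cexp /= expRD cosD sinD.
by apply/eqP; rewrite eq_complex /=; apply/andP; split; apply/eqP; ring.
Qed.

Lemma xi_sqr j : xi K j.+1 ^+ 2 = xi K j.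
Proof.
rewrite expr2 /xi -cexpD; congr cexp.
rewrite exprS invfM -mulrDl.
by field; rewrite ?expf_neq0 // pnatr_eq0.
Qed.

Lemma xi_imag j : xi K j = (cos (2 * pi / 2 ^+ j) +i* sin (2 * pi / 2 ^+ j))%C.
Proof.
have -> : xi K j = cexp (0 +i* (2 * pi / 2 ^+ j))%C.
  rewrite /xi; congr cexp.
  have -> : (2 ^+ j : C) = (2 ^+ j)%:C%C by rewrite rmorphXn rmorph_nat.
  have -> : (2 : C) = 2%:C%C by rewrite rmorph_nat.
  by rewrite -fmorphV -!rmorphM /= mulrAC -rmorphM; simpc.
by rewrite /cexp /= expR0 mul1r.
Qed.

Lemma xi0 : xi K 0 = 1.
Proof. by rewrite xi_imag divr1 mulr_natl cos2pi sin2pi. Qed.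

Lemma xi1 : xi K 1 = -1.
Proof.
rewrite xi_imag expr1 mulrAC divff ?pnatr_eq0// mul1r cospi sinpi.
by apply/eqP; rewrite eq_complex /= oppr0 !eqxx.
Qed.

Lemma xi2 : xi K 2 = 'i%C.
Proof.
rewrite xi_imag (_ : 2 * pi / 2 ^+ 2 = pi / 2); last by field.
by rewrite cos_pihalf sin_pihalf.
Qed.

Lemma xi_exp2 n j : xi K (n + j) ^+ (2 ^ n) = xi K j.
Proof. by elim: n => [|n IHn]; rewrite ?expr1 // expnS exprM xi_sqr. Qed.

Lemma xi_neq0 j : xi K j != 0.
Proof.
have := xi_exp2 j 0; rewrite addn0 xi0 => e.
by apply: contra_eq_neq e => ->; rewrite expr0n expn_eq0 /= eq_sym oner_eq0.
Qed.

Lemma xi_norm j : `|xi K j| = 1.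
Proof.
have := xi_exp2 j 0; rewrite addn0 xi0 => e.
by apply/eqP; rewrite -(@pexpr_eq1 _ _ (2 ^ j)) ?expn_gt0// -normrX e normr1.
Qed.

Lemma xi_norm_exprz j (z : int) : `|xi K j ^ z| = 1.
Proof.
case: z => l; first by rewrite -exprnP normrX xi_norm expr1n.
by rewrite NegzE -invr_expz -exprnP normfV normrX xi_norm expr1n invr1.
Qed.

End RootsOfUnity.

(** * Exponents of [xi K j] modulo 2^j *)

Section Exponents.
Variable K : realType.

(** Since [xi K j] to the power 2^j is 1, its powers are additive in exponents from ['Z_(2 ^ j)].
    This turns the residues in [tau] into plain integer exponents. *)
Lemma xi_Zp j (z : int) : (0 < j)%N ->
  xi K j ^+ (z%:~R : 'Z_(2 ^ j)) = xi K j ^ z.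
Proof.
move=> j_gt0; have n_gt1 : (1 < 2 ^ j)%N by rewrite -{1}(expn0 2) ltn_exp2l.
have xi_order : xi K j ^+ (2 ^ j) = 1 by have := xi_exp2 K j 0; rewrite addn0 xi0.
have xi_nat (n : nat) : xi K j ^+ (n%:R : 'Z_(2 ^ j)) = xi K j ^+ n.
  by rewrite val_Zp_nat// expr_mod.
have xiD (x y : 'Z_(2 ^ j)) : xi K j ^+ (x + y)%R = xi K j ^+ x * xi K j ^+ y.
  by rewrite -exprD -(xi_nat (x + y)%N) natrD !natr_Zp.
case: z => n; first by rewrite -pmulrn xi_nat.
rewrite NegzE mulrNz -pmulrn -invr_expz.
(* Negative exponent: both sides are inverse to [xi K j ^+ n.+1]. *)
apply: (mulfI (expf_neq0 n.+1 (xi_neq0 K j))).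
rewrite -[X in X * _ = _]xi_nat -xiD subrr expr0 divff//; exact/expf_neq0/xi_neq0.
Qed.

Lemma eq_xi_exp j (e f : int) : (0 < j)%N ->
  e%:~R = f%:~R :> 'Z_(2 ^ j) -> xi K j ^ e = xi K j ^ f.
Proof. by move=> j_gt0 ef; rewrite -!xi_Zp// ef. Qed.

End Exponents.

(** * Algebra of iterated tensor products *)

Section TensorProducts.
Variable K : realType.
Local Notation C := K[i].

Lemma eq_tensor p q m (A B : 'I_m -> 'M[C]_(p, q)) : A =1 B -> tensor A = tensor B.
Proof.
elim: m A B => [//|m IHm] A B eqAB /=.
by rewrite eqAB (IHm _ (fun i => B (lift ord0 i))).
Qed.

Lemma mulmx_castmx m m' n n' p p' (em : m = m') (en : n = n') (ep : p = p')
    (A : 'M[C]_(m, n)) (B : 'M[C]_(n, p)) :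
  castmx (em, en) A *m castmx (en, ep) B = castmx (em, ep) (A *m B).
Proof. by case: m' / em; case: n' / en; case: p' / ep. Qed.

Lemma castmx_scale m m' n n' (e : (m = m') * (n = n')) (c : C) (A : 'M[C]_(m, n)) :
  castmx e (c *: A) = c *: castmx e A.
Proof. by apply/matrixP => i j; rewrite !(mxE, castmxE). Qed.

Lemma mul_tensor p q r m (A : 'I_m -> 'M[C]_(p, q)) (B : 'I_m -> 'M[C]_(q, r)) :
  tensor A *m tensor B = tensor (fun i => A i *m B i).
Proof.
elim: m A B => [|m IHm] A B /=; first by rewrite mul1mx.
by rewrite -IHm -tensmx_mul mulmx_castmx.
Qed.

Lemma tensor_adjoint p q m (A : 'I_m -> 'M[C]_(p, q)) :
  ((tensor A)^t*)%sesqui = tensor (fun i => ((A i)^t*)%sesqui).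
Proof.
elim: m A => [|m IHm] A /=; first by rewrite trmx1 map_scalar_mx rmorph1.
by rewrite trmx_cast map_castmx trmx_tens map_mxT IHm.
Qed.

Lemma tensor_scale p q m (c : 'I_m -> C) (A : 'I_m -> 'M[C]_(p, q)) :
  tensor (fun i => c i *: A i) = (\prod_i c i) *: tensor A.
Proof.
elim: m c A => [|m IHm] c A /=; first by rewrite big_ord0 scale1r.
rewrite big_ord_recl IHm -castmx_scale; congr castmx.
by apply/matrixP => i j; rewrite !mxE; ring.
Qed.

Lemma tensmx11 n p : (1%:M : 'M[C]_n) *t (1%:M : 'M[C]_p) = 1%:M.
Proof.
apply/matrixP => i j; case: (mxtens_indexP i) => i1 i2; case: (mxtens_indexP j) => j1 j2.
rewrite tensmxE !mxE (can_eq (@mxtens_indexK n p)) xpair_eqE.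
by case: (i1 == j1); rewrite ?mul1r ?mul0r.
Qed.

Lemma castmx11 n n' (e : n = n') : castmx (e, e) 1%:M = 1%:M :> 'M[C]_n'.
Proof. by case: n' / e. Qed.

Lemma tensor1 p m : tensor (fun _ : 'I_m => 1%:M : 'M[C]_p) = 1%:M.
Proof.
by elim: m => [//|m IHm] /=; rewrite IHm tensmx11 castmx11.
Qed.

End TensorProducts.

(** * Orthonormality of the kets and the diagonal action of [tau] *)

Section Kets.
Variables (K : realType) (m : nat).
Local Notation C := K[i].
Implicit Types v w : 'rV['Z_2]_m.

(** The 0-1 lift to the integers, so that quadratic forms are computed over the integers and reduced
    only afterwards. *)
Definition bits v : 'rV[int]_m := map_mx (fun c : 'Z_2 => (c : nat)%:Z) v.

(** The inner product of product vectors is the product of the inner products of the factors, here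
    Kronecker deltas; one differing coordinate makes it vanish. *)
Lemma ket_adjoint_mul v w : (((ket K v)^t*)%sesqui *m ket K w) = (v == w)%:R%:M.
Proof.
have adj_delta (c : 'Z_2) :
    ((delta_mx c 0 : 'M[C]_(2, 1))^t*)%sesqui = delta_mx 0 c.
  by apply/matrixP => i j; rewrite !mxE rmorph_nat andbC.
rewrite trmx_cast map_castmx mulmx_castmx tensor_adjoint mul_tensor.
rewrite (_ : tensor _ = tensor (fun i => (v 0 i == w 0 i)%:R *: (1%:M : 'M[C]_1))).
  rewrite tensor_scale castmx_scale tensor1 castmx11 scalemx1; congr _%:M.
  rewrite -natr_prod; congr _%:R; case: eqVneq => [->|neq_vw].
    by rewrite big1 // => i _; rewrite eqxx.
  have [i neq_vwi] : exists i, v 0 i != w 0 i.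
    apply/existsP; apply: contraR neq_vw => /existsPn eq_vw; apply/eqP/rowP => i.
    by apply/eqP/negPn/eq_vw.
  by rewrite (bigD1 i) //= (negPf neq_vwi).
apply: eq_tensor => i /=; rewrite adj_delta mul_delta_mx_cond.
rewrite -scaler_nat; congr (_ *: _).
by apply/matrixP => j l; rewrite !ord1 !mxE.
Qed.

(* The 2 ^ m kets are orthonormal, hence the columns of an invertible matrix. *)
Lemma eq_on_kets (A B : 'M[C]_(2 ^ m)) :
  (forall v, A *m ket K v = B *m ket K v) -> A = B.
Proof.
move=> eqAB; have card_v : (2 ^ m = #|{: 'rV['Z_2]_m}|)%N.
  by rewrite card_mx card_ord mul1n.
pose vec (j : 'I_(2 ^ m)) : 'rV['Z_2]_m := enum_val (cast_ord card_v j).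
pose U : 'M[C]_(2 ^ m) := \matrix_(i, j) ket K (vec j) i 0.
have mulU (D : 'M[C]_(2 ^ m)) i j : (D *m U) i j = (D *m ket K (vec j)) i 0.
  by rewrite !mxE; apply: eq_bigr => l _; rewrite mxE.
have UtU : (U^t*)%sesqui *m U = 1%:M.
  apply/matrixP => i j; have /matrixP/(_ 0 0) := ket_adjoint_mul (vec i) (vec j).
  rewrite !mxE eqxx mulr1n (inj_eq enum_val_inj) (inj_eq (@cast_ord_inj _ _ _)) => <-.
  by apply: eq_bigr => l _; rewrite !mxE.
have [_ Uunit] := mulmx1_unit UtU.
rewrite -[A](mulmxK Uunit) -[B](mulmxK Uunit); congr (_ *m _).
by apply/matrixP => i j; rewrite !mulU eqAB.
Qed.

Lemma diag_ket (c : 'rV['Z_2]_m -> C) w :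
  (\sum_v c v *: (ket K v *m ((ket K v)^t*)%sesqui)) *m ket K w = c w *: ket K w.
Proof.
rewrite mulmx_suml (bigD1 w) //= -scalemxAl -mulmxA ket_adjoint_mul eqxx mulmx1.
rewrite big1 ?addr0 // => v /negPf neq_vw.
by rewrite -scalemxAl -mulmxA ket_adjoint_mul neq_vw raddf0 mulmx0 scaler0.
Qed.

Lemma bits_modE j v : bits_mod j v = map_mx intr (bits v).
Proof. by apply/rowP => i; rewrite !mxE -pmulrn. Qed.

Lemma tau_ket j (S : 'M[int]_m) v : (0 < j)%N ->
  tau K (reduce (2 ^ j) S) *m ket K v
  = xi K j ^ ((bits v *m S *m (bits v)^T) 0 0) *: ket K v.
Proof.
move=> j_gt0; rewrite /tau diag_ket; congr (_ *: _).
by rewrite bits_modE map_trmx -!map_mxM mxE xi_Zp.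
Qed.

Lemma tau_adjoint_ket j (S : 'M[int]_m) v : (0 < j)%N ->
  ((tau K (reduce (2 ^ j) S))^t*)%sesqui *m ket K v
  = (xi K j ^ ((bits v *m S *m (bits v)^T) 0 0))^-1 *: ket K v.
Proof.
move=> j_gt0; rewrite /tau.
rewrite [(_^t*)%sesqui](_ : _ = \sum_v
  (xi K j ^+ ((bits_mod j v *m reduce (2 ^ j) S *m (bits_mod j v)^T) 0 0
     : 'Z_(2 ^ j)))^* *: (ket K v *m ((ket K v)^t*)%sesqui)).
  rewrite diag_ket; congr (_ *: _).
  (* The phase has modulus 1, so its conjugate is its inverse. *)
  rewrite -(@xi_Zp K j) // invC_norm normrX xi_norm !expr1n invr1 mul1r.
  by rewrite bits_modE map_trmx -!map_mxM mxE.
(* Each projector is self-adjoint, so the adjoint only conjugates the coefficients. *)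
rewrite raddf_sum raddf_sum /=; apply: eq_bigr => w _.
rewrite linearZ /= map_mxZ trmx_mul map_mxM map_trmx trmxK /=.
by congr (_ *: (_ *m _)); apply/matrixP => i l; rewrite !mxE /= conjCK.
Qed.

End Kets.

(** * Action of the Pauli operators on the kets *)

Section Paulis.
Variable K : realType.
Local Notation C := K[i].

(** An involution is its own inverse, so only the parity of the exponent counts, also for negative
    exponents. *)
Lemma involution_exprz n (A : 'M[C]_n.+1) (z : int) : A * A = 1 ->
  A ^ z = A ^+ odd `|z|%N.
Proof.
move=> AA; have A_unit : A \is a GRing.unit by apply/unitrP; exists A.
have AV : A^-1 = A by rewrite -[RHS]mul1r -(mulVr A_unit) -mulrA AA mulr1.
have A_nat (l : nat) : A ^+ l = A ^+ odd l.
  by rewrite -{1}(odd_double_half l) exprD -muln2 mulnC exprM expr2 AA expr1n mulr1.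
case: z => l; first exact: A_nat.
rewrite NegzE abszN -invr_expz -exprnP -exprVn AV; exact: A_nat.
Qed.

Lemma intr_Z2 (z : int) : z%:~R = (odd `|z|%N)%:R :> 'Z_2.
Proof.
have nat_Z2 (l : nat) : l%:R = (odd l)%:R :> 'Z_2.
  by apply: ord_inj; rewrite !val_Zp_nat // !modn2 oddb.
have N_Z2 (c : 'Z_2) : - c = c by apply: val_inj; case: c => [[|[|]]].
case: z => l; first exact: nat_Z2.
by rewrite NegzE mulrNz abszN N_Z2; exact: nat_Z2.
Qed.

Lemma pauliX_ket (x : int) (c : 'Z_2) :
  pauliX K ^ x *m delta_mx c (0 : 'I_1) = delta_mx (c + x%:~R) 0.
Proof.
rewrite involution_exprz; last first.
  apply/matrixP => i j; rewrite !mxE big_ord_recl big_ord1 !mxE.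
  by case: i j => [[|[|]] // ?] [[|[|]] // ?]; rewrite /=; ring.
rewrite intr_Z2; case: odd; rewrite ?expr0 ?expr1 ?addr0 ?mul1mx //.
apply/matrixP => i j; rewrite !mxE big_ord_recl big_ord1 !mxE ord1.
case: c i => [[|[|]] // ?] [[|[|]] // ?]; rewrite /=; ring.
Qed.

Lemma pauliZ_ket (y : int) (c : 'Z_2) :
  pauliZ K ^ y *m delta_mx c (0 : 'I_1) = (-1) ^ (y * (c : nat)%:Z) *: delta_mx c 0.
Proof.
rewrite involution_exprz; last first.
  apply/matrixP => i j; rewrite !mxE big_ord_recl big_ord1 !mxE.
  by case: i j => [[|[|]] // ?] [[|[|]] // ?]; rewrite /=; ring.
rewrite expN1r abszM -signr_odd oddM /=; case: odd; last by rewrite mul1mx scale1r.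
apply/matrixP => i j; rewrite !mxE big_ord_recl big_ord1 !mxE ord1.
by case: c i => [[|[|]] // ?] [[|[|]] // ?]; rewrite /=; ring.
Qed.

Variable m : nat.

(** In each factor the power of Z acts first and reads its sign off the unshifted bit; the power of
    X then shifts that bit. *)
Lemma opD_ket (x y : 'rV[int]_m) (v : 'rV['Z_2]_m) :
  opD K x y *m ket K v
  = (-1) ^ ((y *m (bits v)^T) 0 0) *: ket K (v + map_mx intr x).
Proof.
rewrite /opD /ket -[tensor _](castmx_id (erefl, erefl)) mulmx_castmx mul_tensor.
rewrite -castmx_scale; congr castmx.
rewrite (_ : (-1) ^ _ = \prod_i (-1) ^ (y 0 i * (v 0 i : nat)%:Z)); last first.
  rewrite !mxE; elim/big_rec2: _ => // i s t _ <-.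
  by rewrite expfzDr ?oppr_eq0 ?oner_eq0 // !mxE.
rewrite -tensor_scale; apply: eq_tensor => i.
by rewrite -mulmxE -mulmxA (pauliZ_ket (y ord0 i) (v 0 i)) -scalemxAr
  (pauliX_ket (x ord0 i) (v 0 i)) !mxE.
Qed.

End Paulis.

(** * Binary digits, bilinear forms and the congruence of exponents *)

Lemma modz2P (z : int) : {c : bool | (z %% 2)%Z = (c : nat)%:Z}.
Proof.
have := modz_ge0 z (isT : 2%:Z != 0); have := ltz_pmod z (isT : 0 < 2%:Z).
by case: (z %% 2)%Z => [[|[|]]|] // _ _; [exists false | exists true].
Qed.

Section Digits.
Variable m : nat.
Implicit Types (v : 'rV['Z_2]_m) (a x y z d : 'rV[int]_m) (S : 'M[int]_m).

Lemma digit0E a : digit 0 a = map_mx (fun z : int => (z %% 2)%Z) a.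
Proof. by apply/rowP => i; rewrite !mxE expr0 divz1. Qed.

(** Isolates the part of [a] beyond its residue modulo 4, which disappears once multiplied by
    2^(k-2) modulo 2^k. *)
Lemma digit_expansion a : exists a2, a = digit 0 a + 2 *: digit 1 a + 4 *: a2.
Proof.
exists (map_mx (fun z : int => divz (divz z 2) 2) a); apply/rowP => i.
rewrite digit0E !mxE expr1.
rewrite {1}(divz_eq (a 0 i) 2) {1}(divz_eq (divz (a 0 i) 2) 2); ring.
Qed.

Lemma map_digit0 a : map_mx intr (digit 0 a) = map_mx intr a :> 'rV['Z_2]_m.
Proof.
rewrite digit0E; apply/rowP => i; rewrite !mxE {2}(divz_eq (a 0 i) 2).
move: (modz _ _) (divz _ _) => r q; rewrite intrD intrM.
by rewrite [X in _ * X](_ : _ = 0) ?mulr0 ?add0r //; apply: val_inj.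
Qed.

(** Entrywise, the sum modulo 2 of bits c and d is c + d - 2cd; the diagonal matrix encodes the
    entrywise product. *)
Lemma bits_shift v a :
  bits (v + map_mx intr a)
  = bits v + digit 0 a - 2 *: (bits v *m diag_mx (digit 0 a)).
Proof.
rewrite -map_digit0 digit0E mul_mx_diag; apply/rowP => i; rewrite !mxE.
have [c ->] := modz2P (a 0 i).
by case: (v 0 i) c => [[|[|]] // ?] [].
Qed.

(** A scalar-valued pairing whose values serve as atoms for [ring] once bilinearity has been
    used. *)
Definition dot x y : int := (x *m y^T) 0 0.

Lemma dotDl x y z : dot (x + y) z = dot x z + dot y z.
Proof. by rewrite /dot mulmxDl mxE. Qed.

Lemma dotZl c x y : dot (c *: x) y = c * dot x y.
Proof. by rewrite /dot -scalemxAl mxE. Qed.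

Lemma dotNl x y : dot (- x) y = - dot x y.
Proof. by rewrite /dot mulNmx mxE. Qed.

Lemma dotC x y : dot x y = dot y x.
Proof. by rewrite /dot !mxE; apply: eq_bigr => i _; rewrite !mxE mulrC. Qed.

Lemma dotDr x y z : dot x (y + z) = dot x y + dot x z.
Proof. by rewrite dotC dotDl !(dotC x). Qed.

Lemma dotZr c x y : dot x (c *: y) = c * dot x y.
Proof. by rewrite dotC dotZl (dotC x). Qed.

Lemma dotNr x y : dot x (- y) = - dot x y.
Proof. by rewrite dotC dotNl (dotC x). Qed.

Lemma dot_diag x d y : dot (x *m diag_mx d) y = dot x (y *m diag_mx d).
Proof. by rewrite /dot trmx_mul tr_diag_mx mulmxA. Qed.

(** Bits are idempotent, so a diagonal quadratic form is linear on them. *)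
Lemma dot_bits_diag v d : dot (bits v) (bits v *m diag_mx d) = dot d (bits v).
Proof.
rewrite -dot_diag /dot mul_mx_diag !mxE; apply: eq_bigr => i _; rewrite !mxE.
by case: (v 0 i) => [[|[|]] // ?]; rewrite ?mul1r ?mul0r ?mulr0.
Qed.

Definition dotE := (mulmxDl, mulNmx, mulmxDr, mulmxN, dotDl, dotDr, dotZl, dotZr,
  dotNl, dotNr).

(** A 1 x 1 matrix equals its transpose. The equality holds only after reduction, as the integer
    lift [S] is symmetric only modulo [n]. *)
Lemma dot_sym n S x y : reduce n S = (reduce n S)^T ->
  (dot (x *m S) y)%:~R = (dot (y *m S) x)%:~R :> 'Z_n.
Proof.
have dot_map x' y' : (dot (x' *m S) y')%:~R
    = (map_mx intr x' *m reduce n S *m (map_mx intr y')^T) 0 0 :> 'Z_n.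
  by rewrite map_trmx -!map_mxM [RHS]mxE.
have tr11 (A : 'M['Z_n]_1) : A 0 0 = A^T 0 0 by rewrite mxE.
move=> S_sym; rewrite !dot_map.
by rewrite [RHS]tr11 !trmx_mul trmxK -S_sym mulmxA.
Qed.

(* An integer lift of Rtilde: it is reduced modulo 2 ^ (k - 1), but twice its
   quadratic form has to be evaluated modulo 2 ^ k. *)
Definition RtildeZ S a k : 'M[int]_m :=
  let a0 := digit 0 a in
  (1 + 2 ^+ (k - 2)) *: diag_mx (a0 *m S)
     - (diag_mx (bar a0) *m S *m diag_mx a0
        + diag_mx a0 *m S *m diag_mx (bar a0)
        + 2 *: diag_mx (a0 *m S *m diag_mx a0)).

(** The diagonal terms become linear by idempotence; in the others D_{a_0} turns v into [u], its
    entrywise product with a_0, and the complementary diagonal matrix turns v into v - [u]. *)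
Lemma dot_RtildeZ S a k v (a0 := digit 0 a) (u := bits v *m diag_mx a0) :
  dot (bits v *m RtildeZ S a k) (bits v)
  = (1 + 2 ^+ (k - 2)) * dot (a0 *m S) (bits v)
    - (dot ((bits v - u) *m S) u + dot (u *m S) (bits v - u)
       + 2 * dot (a0 *m S) u).
Proof.
have barE : bits v *m diag_mx (bar a0) = bits v - u.
  by rewrite /bar raddfB /= mulmxBr diag_const_mx mulmx1.
rewrite /RtildeZ -/a0 mulmxBr !mulmxDr -!scalemxAr !mulmxA !(dotDl, dotNl, dotZl).
by rewrite !dot_diag !dot_bits_diag !barE dot_diag.
Qed.

Lemma phase_congruence S a b v k (w := v + map_mx intr a)
    (a0 := digit 0 a) (b0 := digit 0 b) : (2 <= k)%N ->
  reduce (2 ^ k) S = (reduce (2 ^ k) S)^T ->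
  (dot (bits w *m S) (bits w) - dot (bits v *m S) (bits v)
   + (2 ^+ (k - 2) * dot a b + 2 ^+ (k - 1) * dot b (bits v)))%:~R
  = (phi S a b k + 2 * dot (bits v *m RtildeZ S a k) (bits v)
     + (2 ^+ (k - 2) * dot a0 (b0 + a0 *m S)
        + 2 ^+ (k - 1) * dot (b0 + a0 *m S) (bits v)))%:~R :> 'Z_(2 ^ k).
Proof.
rewrite /phi => k_ge2 S_sym; set P := 'Z_(2 ^ k).
(* All powers of 2 are expressed through q = 2^(k-2), whose only needed property is that 4q = 0
   modulo 2^k. *)
have -> : 2 ^+ (k - 1) = 2 * 2 ^+ (k - 2) :> int.
  by rewrite -exprS; congr (_ ^+ _); case: (k) k_ge2 => [|[|l]] // _; rewrite subn1 subn2.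
have four_q : 4 * (2 ^+ (k - 2))%:~R = 0 :> P.
  have -> : 4 = (2 ^ 2)%:R :> P by [].
  rewrite rmorphXn /= -natrX -natrM -expnD subnKC // pchar_Zp //.
  by rewrite -{1}(expn0 2) ltn_exp2l ?(ltnW k_ge2).
rewrite dot_RtildeZ.
rewrite -/(dot (digit 0 a *m S) (digit 0 a)) -/(dot (digit 0 a) (digit 1 b)).
rewrite -/(dot (digit 0 b) (digit 1 a)).
rewrite bits_shift -/a0 -/b0; set a1 := digit 1 a; set b1 := digit 1 b.
have [a2 a_eq] := digit_expansion a; have [b2 b_eq] := digit_expansion b.
have [x dot_ab] : exists x : int,
    dot a b = dot a0 b0 + 2 * (dot a0 b1 + dot b0 a1) + 4 * x.
  exists (dot a0 b2 + dot a1 b1 + 2 * dot a1 b2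
    + dot a2 b0 + 2 * dot a2 b1 + 4 * dot a2 b2).
  rewrite (dotC b0 a1) {1}a_eq {1}b_eq -/a0 -/b0 -/a1 -/b1 !dotE.
  ring.
have [y dot_bv] : exists y : int, dot b (bits v) = dot b0 (bits v) + 2 * y.
  exists (dot b1 (bits v) + 2 * dot b2 (bits v)).
  by rewrite {1}b_eq -/b0 -/b1 !dotE; ring.
have sym x' y' : (dot (x' *m S) y')%:~R = (dot (y' *m S) x')%:~R :> P by apply: dot_sym.
rewrite dot_ab dot_bv; set u := bits v *m diag_mx a0.
rewrite !dotE -!scalemxAl !dotE (dotC a0 (a0 *m S)).
rewrite !(rmorphD, rmorphM, rmorphN, rmorphB) /=.
(* Symmetry is available only modulo 2^k, hence after the casts; it gives each mixed term one
   orientation. *)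
rewrite (sym u (bits v)) (sym u a0) (sym (bits v) a0).
(* The exact discrepancy is 4q times this factor: x and y collect what the digit expansions leave
   over, and a_0 R v^T occurs with 2q from twice the form of [RtildeZ] and 2q from the sign of
   E(a_0, b_0 + a_0 R). *)
rewrite -[RHS]addr0 -[0](mul0r (x%:~R + y%:~R - (dot (a0 *m S) (bits v))%:~R)) -four_q.
ring.
Qed.

End Digits.

(** * Symmetry of [Rtilde] *)

Lemma intr_Zp_eq0 n (z : int) : (1 < n)%N -> (z%:~R == 0 :> 'Z_n) = (n%:Z %| z)%Z.
Proof.
move=> n_gt1; have nat_eq0 (l : nat) : (l%:R == 0 :> 'Z_n) = (n %| l)%N.
  by rewrite -(inj_eq val_inj) /= val_Zp_nat.
rewrite dvdzE absz_nat; case: z => l; first exact: nat_eq0.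
by rewrite NegzE mulrNz oppr_eq0 abszN; exact: nat_eq0.
Qed.

Lemma reduce_tr m n (S : 'M[int]_m) : reduce n S^T = (reduce n S)^T.
Proof. by rewrite /reduce map_trmx. Qed.

Lemma reduce_dvd_sym m n n' (S : 'M[int]_m) : (1 < n')%N -> (1 < n)%N -> (n' %| n)%N ->
  (reduce n S)^T = reduce n S -> (reduce n' S)^T = reduce n' S.
Proof.
move=> n'_gt1 n_gt1 n'_n /matrixP S_sym; apply/matrixP => i j.
have := S_sym i j; rewrite !mxE => /eqP; rewrite -subr_eq0 -mulrzBr intr_Zp_eq0 // => n_S.
apply/eqP; rewrite -subr_eq0 -mulrzBr intr_Zp_eq0 //.
exact: dvdz_trans n_S.
Qed.

(** Symmetry modulo 2^k descends to the modulus 2^(k-1). Transposition then exchanges the two mixed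
    products and fixes the diagonal terms. *)
Lemma Rtilde_sym m k (S : 'M[int]_m) (a : 'rV[int]_m) : (2 <= k)%N ->
  (reduce (2 ^ k) S)^T = reduce (2 ^ k) S -> (Rtilde S a k)^T = Rtilde S a k.
Proof.
move=> k_ge2 S_sym.
have : (reduce (2 ^ (k - 1)) S)^T = reduce (2 ^ (k - 1)) S.
  apply: reduce_dvd_sym S_sym; rewrite ?dvdn_exp2l ?leq_subr //.
    by rewrite -{1}(expn0 2) ltn_exp2l ?subn_gt0.
  by rewrite -{1}(expn0 2) ltn_exp2l ?(ltnW k_ge2).
rewrite -reduce_tr /Rtilde -reduce_tr; set a0 := digit 0 a => S_sym'.
set A := diag_mx (bar a0); set D := diag_mx a0.
have trE (X Y Z W : 'M[int]_m) : (X - (Y + Z + W))^T = X^T - (Y^T + Z^T + W^T).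
  by apply/matrixP => i j; rewrite !mxE.
have redE (X Y Z W : 'M[int]_m) : reduce (2 ^ (k - 1)) (X - (Y + Z + W))
    = reduce _ X - (reduce _ Y + reduce _ Z + reduce _ W).
  by rewrite /reduce map_mxB !map_mxD.
have redM (X Y : 'M[int]_m) :
    reduce (2 ^ (k - 1)) (X *m S^T *m Y) = reduce _ (X *m S *m Y).
  by rewrite /reduce !map_mxM /= -/(reduce _ S^T) S_sym'.
rewrite trE !trmx_mul !tr_diag_mx !mulmxA redE.
rewrite !redM [reduce _ (D *m _ *m A) + _]addrC redE.
by congr (_ - (_ + _)); congr reduce; apply/matrixP => i j;
  rewrite !mxE eq_sym; case: eqP => // ->.
Qed.

(** * Both sides of the identity evaluated on kets *)

Section Main.
Variables (K : realType) (m : nat).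
Local Notation C := K[i].

(** Expresses 'i, -1 and [xi K (k - 1)] as powers of the single root [xi K k]. *)
Lemma xi_exp_expn j k : (j <= k)%N -> xi K k ^ (2 ^+ (k - j)) = xi K j.
Proof.
by move=> jk; rewrite -natrX natz -exprnP -(xi_exp2 K (k - j) j) subnK.
Qed.

Lemma imaginary_exp_mod4 (z : int) : 'i%C ^ (z %% 4)%Z = 'i%C ^ z :> C.
Proof.
rewrite -xi2 {2}(divz_eq z 4); move: (modz _ _) (divz _ _) => r q.
rewrite expfzDr ?xi_neq0 // mulrC [q * 4]mulrC -exprz_exp.
have -> : 4%R = (2 ^+ (2 - 0))%R :> int by [].
by rewrite xi_exp_expn // xi0 exp1rz mulr1.
Qed.

Lemma opE_ket k (x y : 'rV[int]_m) (v : 'rV['Z_2]_m) : (2 <= k)%N ->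
  opE K x y *m ket K v
  = xi K k ^ (2 ^+ (k - 2) * dot x y + 2 ^+ (k - 1) * dot y (bits v))
      *: ket K (v + map_mx intr x).
Proof.
move=> k_ge2; rewrite /opE -scalemxAl opD_ket scalerA imaginary_exp_mod4.
rewrite -/(dot x y) -/(dot y (bits v)); move: (dot x y) (dot y (bits v)) => s t.
rewrite expfzDr ?xi_neq0 // -(exprz_exp _ _ s) -(exprz_exp _ _ t).
by rewrite (xi_exp_expn k_ge2) (xi_exp_expn (ltnW k_ge2)) xi1 xi2.
Qed.

(** The adjoint of [tau] contributes the inverse phase at v, and [tau] itself the phase at the
    shifted vector [w]. *)
Lemma conj_opE_ket k (S : 'M[int]_m) (a b : 'rV[int]_m) (v : 'rV['Z_2]_m)
    (w := v + map_mx intr a) : (2 <= k)%N ->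
  tau K (reduce (2 ^ k) S) *m opE K a b *m ((tau K (reduce (2 ^ k) S))^t*)%sesqui
    *m ket K v
  = xi K k ^ (dot (bits w *m S) (bits w) - dot (bits v *m S) (bits v)
     + (2 ^+ (k - 2) * dot a b + 2 ^+ (k - 1) * dot b (bits v))) *: ket K w.
Proof.
move=> k_ge2; rewrite -!mulmxA tau_adjoint_ket ?(ltnW k_ge2) //.
rewrite -!scalemxAr (opE_ket _ _ _ k_ge2) -!scalemxAr tau_ket ?(ltnW k_ge2) //.
rewrite !scalerA -/w; congr (_ *: _).
rewrite -/(dot (bits w *m S) (bits w)) -/(dot (bits v *m S) (bits v)).
move: (dot (bits w *m S) _) (dot (bits v *m S) _) (_ + _) => s t r.
by rewrite invr_expz -!expfzDr ?xi_neq0 //; congr (_ ^ _); ring.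
Qed.

(** The factor 2 on the quadratic form comes from [xi K (k - 1)] being the square of [xi K k]. *)
Lemma opE_tau_ket k (S : 'M[int]_m) (x y : 'rV[int]_m) (v : 'rV['Z_2]_m) : (2 <= k)%N ->
  opE K x y *m tau K (reduce (2 ^ (k - 1)) S) *m ket K v
  = xi K k ^ (2 * dot (bits v *m S) (bits v)
     + (2 ^+ (k - 2) * dot x y + 2 ^+ (k - 1) * dot y (bits v)))
     *: ket K (v + map_mx intr x).
Proof.
move=> k_ge2; have k1_gt0 : (0 < k - 1)%N by rewrite subn_gt0.
rewrite -mulmxA tau_ket // -scalemxAr (opE_ket _ _ _ k_ge2) scalerA; congr (_ *: _).
rewrite -/(dot (bits v *m S) (bits v)); move: (dot (bits v *m S) _) (_ + _) => s t.
rewrite -(@xi_exp_expn (k - 1) k) ?leq_subr // subKn ?(ltnW k_ge2) // exprz_exp expr1.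
by rewrite -expfzDr ?xi_neq0.
Qed.

End Main.

(** * The conjugation identity *)

Local Open Scope sesquilinear_scope.

(* R is the symmetric matrix over Z / 2 ^ k and Rz is any matrix of integers
   representing its entries (Rz itself need not be symmetric). *)
Theorem corollary5 (K : realType) (m k : nat) (hm : (1 <= m)%N) (hk : (2 <= k)%N)
    (R : 'M['Z_(2 ^ k)]_m) (R_sym : R^T = R)
    (Rz : 'M[int]_m) (Rz_repr : reduce (2 ^ k) Rz = R)
    (a b : 'rV[int]_m) :
  let a0 := digit 0 a in
  let b0 := digit 0 b in
  [/\ tau K R *m opE K a b *m (tau K R)^t*
      = xi K k ^ phi Rz a b k *:
          (opE_row K (row_mx a0 b0 *m Gamma Rz) *m tau K (Rtilde Rz a k)),
      row_mx a0 b0 *m Gamma Rz = row_mx a0 (b0 + a0 *m Rz),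
      (Rtilde Rz a k)^T = Rtilde Rz a k
    & phase_eq (tau K R *m opE K a b *m (tau K R)^t*)
        (opE K a0 (b0 + a0 *m Rz) *m tau K (Rtilde Rz a k))].
Proof.
move=> a0 b0.
have R_sym' : (reduce (2 ^ k) Rz)^T = reduce (2 ^ k) Rz by rewrite Rz_repr.
have GammaE : row_mx a0 b0 *m Gamma Rz = row_mx a0 (b0 + a0 *m Rz).
  by rewrite /Gamma mul_row_block !mulmx1 mulmx0 addr0 addrC.
have main : tau K R *m opE K a b *m (tau K R)^t*
    = xi K k ^ phi Rz a b k *:
      (opE_row K (row_mx a0 b0 *m Gamma Rz) *m tau K (Rtilde Rz a k)).
  rewrite GammaE /opE_row row_mxKl row_mxKr -Rz_repr.
  apply: eq_on_kets => v; rewrite conj_opE_ket // -scalemxAl opE_tau_ket // scalerA.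
  (* As [a] and [a0] agree modulo 2, both sides reach the same ket and only the phases remain to be
     compared. *)
  rewrite map_digit0 -expfzDr ?xi_neq0 // [in RHS]addrA; congr (_ *: _).
  apply: eq_xi_exp; first exact: ltnW.
  (* [Rtilde] is by definition the reduction of [RtildeZ], so the exponents match up to
     conversion. *)
  exact: phase_congruence hk (esym R_sym').
split=> //; first exact: Rtilde_sym.
exists (exprz (xi K k) (phi Rz a b k)); first exact: xi_norm_exprz.
by rewrite main GammaE /opE_row row_mxKl row_mxKr.
Qed.
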